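(* Let $p$ satisfy hypothesis (H) on $(a,b)$, let $p_h(t,0)\neq0$ for all $t\in(a,b)$, and suppose that for each $t\in(a,b)$ $$\lim_{\varepsilon\to0}\frac{\varepsilon}{h(t,\varepsilon)}\neq0,$$ where $h(t,\varepsilon)$ is the solution of $p(t,h)=t\pm\varepsilon$ from hypothesis (H). Let $f,g$ be continuous on $[a,b]$ and $p$-differentiable on $(a,b)$, with $D_pg(t)\neq0$ for all $t\in(a,b)$. Then there exists $c\in(a,b)$ such that $$\frac{f(b)-f(a)}{g(b)-g(a)}=\frac{D_pf(c)}{D_pg(c)}.$$
   Context: Here $p(t,h)$ is a real-valued function defined for $t\in(a,b)$ and $|h|<\delta$, where $\delta>0$ is generally unspecified (it may depend on $t$), with values in $[a,b]$, and $p_h=\partial p/\partial h$. A function $f:[a,b]\to\mathbb{R}$ is $p$-differentiable at $t\in(a,b)$ if $$D_pf(t)=\lim_{h\to0}\frac{f(p(t,h))-f(t)}{h}$$ exists and is finite. Hypothesis (H) on $(a,b)$: for each $t\in(a,b)$, $p(t,h)$ and $p_h(t,h)$ exist and are continuous (in $h$) in a neighborhood of $h=0$; and for each $t\in(a,b)$, for each choice of sign and all sufficiently small $\varepsilon>0$, the equation $p(t,h)=t\pm\varepsilon$ has a solution $h=h(t,\varepsilon)$ such that $h\to0$ as $\varepsilon\to0$. *)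

(* Defs.v *)
From HB Require Import structures.
From mathcomp Require Import all_boot all_order all_algebra.
From mathcomp Require Import all_classical all_reals all_analysis.
Import Order.TTheory GRing.Theory Num.Theory numFieldNormedType.Exports.

Set Implicit Arguments.
Unset Strict Implicit.
Unset Printing Implicit Defensive.

Local Open Scope classical_set_scope.
Local Open Scope ring_scope.

(* Functions given on [a, b], and p given for |h| < delta, are represented by
   total functions; their values outside these domains are never used. *)

Definition valued_in (R : realType) (a b : R) (p : R -> R -> R) : Prop :=
  forall t : R, t \in `]a, b[ ->
    exists2 delta : R, 0 < delta &
      forall h : R, `|h| < delta -> p t h \in `[a, b].

Definition p_quotient (R : realType) (p : R -> R -> R) (f : R -> R) (t : R)
    : R -> R :=
  fun h => (f (p t h) - f t) / h.

Definition p_differentiable (R : realType) (p : R -> R -> R) (f : R -> R)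
    (t : R) : Prop :=
  cvg (p_quotient p f t h @[h --> (0 : R)^']).

(* As for [derive], the value is meaningful only under [p_differentiable]. *)
Definition Dp (R : realType) (p : R -> R -> R) (f : R -> R) (t : R) : R :=
  lim (p_quotient p f t h @[h --> (0 : R)^']).

Definition partial_h (R : realType) (p : R -> R -> R) (t h : R) : R :=
  derive1 (p t) h.

(* [h] is a solution branch eps |-> h(t, eps) of p(t, h) = t + eps
   (s = false) or of p(t, h) = t - eps (s = true).  Since h(t, eps) tends
   to 0, it lies in the domain |h| < delta for all small eps. *)
Definition solution_branch (R : realType) (p : R -> R -> R) (s : bool) (t : R)
    (h : R -> R) : Prop :=
  (\forall eps \near (0 : R)^'+, p t (h eps) = t + (-1) ^+ s * eps) /\
  h eps @[eps --> (0 : R)^'+] --> (0 : R).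

Definition hypothesis_H (R : realType) (a b : R) (p : R -> R -> R) : Prop :=
  (forall t : R, t \in `]a, b[ ->
     \forall h \near (0 : R),
       [/\ {for h, continuous (p t)},
           derivable (p t) h 1 &
           {for h, continuous (partial_h p t)}]) /\
  (forall t : R, t \in `]a, b[ -> forall s : bool,
     exists h : R -> R, solution_branch p s t h).

(* Main.v *)
Require Import Defs.
From HB Require Import structures.
From mathcomp Require Import all_boot all_order all_algebra.
From mathcomp Require Import all_classical all_reals all_analysis.
Import Order.TTheory GRing.Theory Num.Theory numFieldNormedType.Exports.

Local Open Scope classical_set_scope.
Local Open Scope ring_scope.

(** The hypotheses force [f] and [g] to be differentiable in the ordinary
    sense, so that the classical Cauchy mean value theorem applies.

    Let [P := p_h(t, 0)], which is nonzero.  Continuity of [p(t, .)] along a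
    solution branch gives [p(t, 0) = t] ([solution_branch_base]).  Hence
    [(p(t, h) - t) / h --> P], and dividing the [p]-quotient of [f] by it,
<<
      (f(p(t, h)) - f(t)) / (p(t, h) - t)  -->  D_p f(t) / P
>>
    as [h --> 0] ([cvg_secant_slope]).  Along a branch [h(t, eps)], which
    tends to [0] without vanishing ([solution_branch_dnbhs]), the left-hand
    side is the ordinary difference quotient of [f] at [t] with increment
    [eps] or [- eps].  The two branches together yield
    [f'(t) = D_p f(t) / P] ([p_differentiable_is_derive]).

    As [P] depends on [t] alone, it cancels in [f'(c) / g'(c)], which is
    therefore [D_p f(c) / D_p g(c)], and [g'] does not vanish because [D_p g]
    does not. *)

Section solution_branch_theory.
Context {R : realType} {p : R -> R -> R} {t : R}.

(** Both [t +- eps] and, by continuity, [p(t, 0)] are limits of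
    [p(t, h(t, eps))]. *)
Lemma solution_branch_base {s : bool} {k : R -> R} :
  {for 0, continuous (p t)} -> solution_branch p s t k -> p t 0 = t.
Proof.
move=> pc [pk k0].
have pk0 : p t (k eps) @[eps --> (0 : R)^'+] --> p t 0 by exact: continuous_cvg.
apply: (cvg_unique _ pk0) => //.
have t0 : t + (-1) ^+ s * eps @[eps --> (0 : R)^'+] --> t.
  rewrite -[X in _ --> X]addr0; apply: cvgD; first exact: cvg_cst.
  rewrite -[X in _ --> X](mulr0 ((-1) ^+ s)); apply: cvgM; first exact: cvg_cst.
  exact: cvg_within.
by apply: cvg_trans t0; apply: near_eq_cvg; apply: filterS pk.
Qed.

(** A branch cannot vanish, since [p(t, 0) = t] differs from [t +- eps]; so
    limits at the punctured neighborhood of [0] may be composed with it. *)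
Lemma solution_branch_dnbhs {s : bool} {k : R -> R} :
  p t 0 = t -> solution_branch p s t k ->
  k eps @[eps --> (0 : R)^'+] --> (0 : R)^'.
Proof.
move=> pt0 [pk k0] A /= A0; have := k0 _ A0 => /= kA.
rewrite nbhs_simpl /=; near=> eps.
have eps0 : 0 < eps by near: eps; exact: nbhs_right_gt.
have kepsA : k eps != 0 -> A (k eps) by near: eps.
apply: kepsA; apply/eqP => keps0.
have : p t (k eps) = t + (-1) ^+ s * eps by near: eps.
rewrite keps0 pt0 -{1}[t]addr0 => /addrI /esym /eqP.
by rewrite mulf_eq0 signr_eq0 (gt_eqF eps0).
Unshelve. all: by end_near. Qed.

(** The quotient of [(f(p(t, h)) - f(t)) / h] by [(p(t, h) - t) / h]. *)
Lemma cvg_secant_slope {f : R -> R} :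
  p t 0 = t -> derivable (p t) 0 1 -> partial_h p t 0 != 0 ->
  p_differentiable p f t ->
  (f (p t h) - f t) / (p t h - t) @[h --> (0 : R)^'] -->
    Dp p f t / partial_h p t 0.
Proof.
move=> pt0 dp P0 df.
have dpt : (p t h - t) / h @[h --> (0 : R)^'] --> partial_h p t 0.
  rewrite /partial_h derive1E; apply: cvg_trans dp; apply: near_eq_cvg.
  by near=> h; rewrite /= addr0 pt0 [h%:A]mulr1 [_ *: _]mulrC.
have fdp : p_quotient p f t h * ((p t h - t) / h)^-1 @[h --> (0 : R)^'] -->
    Dp p f t / partial_h p t 0 by exact: cvgM df (cvgV P0 dpt).
apply: cvg_trans fdp; apply: near_eq_cvg; near=> h.
have h0 : h != 0 by near: h; exact: nbhs_dnbhs_neq.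
by rewrite /p_quotient /= invf_div mulrA divfK.
Unshelve. all: by end_near. Qed.

Lemma cvg_branch_slope {f : R -> R} {s : bool} {k : R -> R} {l : R} :
  p t 0 = t -> solution_branch p s t k ->
  (f (p t h) - f t) / (p t h - t) @[h --> (0 : R)^'] --> l ->
  (f (t + (-1) ^+ s * eps) - f t) / ((-1) ^+ s * eps) @[eps --> (0 : R)^'+]
    --> l.
Proof.
move=> pt0 kb fl; have flk := cvg_comp _ _ (solution_branch_dnbhs pt0 kb) fl.
apply: cvg_trans flk; apply: near_eq_cvg; case: kb => pk _.
by apply: filterS pk => eps /= ->; rewrite (addrC t) addrK (addrC _ t).
Qed.

Lemma p_differentiable_is_derive {k : bool -> R -> R} {f : R -> R} :
  derivable (p t) 0 1 -> {for 0, continuous (p t)} -> partial_h p t 0 != 0 ->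
  (forall s, solution_branch p s t (k s)) ->
  p_differentiable p f t ->
  is_derive t 1 f (Dp p f t / partial_h p t 0).
Proof.
move=> dp pc P0 kb df.
have pt0 := solution_branch_base pc (kb false).
have slope s := cvg_branch_slope pt0 (kb s) (cvg_secant_slope pt0 dp P0 df).
have cvg_slope : (f (t + h) - f t) / h @[h --> (0 : R)^'] -->
    Dp p f t / partial_h p t 0.
  apply: (@cvg_at_right_left_dnbhs _ R^o).
    by apply: cvg_trans (slope false); apply: near_eq_cvg; near=> h;
      rewrite /= mul1r.
  apply/cvg_at_leftNP; rewrite oppr0.
  by apply: cvg_trans (slope true); apply: near_eq_cvg; near=> h;
    rewrite /= mulN1r.
have f't : h^-1 *: ((f \o shift t) (h *: 1) - f t) @[h --> (0 : R)^']
    --> Dp p f t / partial_h p t 0.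
  apply: cvg_trans cvg_slope; apply: near_eq_cvg; near=> h.
  by rewrite /= [h *: _]mulr1 [_ *: _]mulrC (addrC h).
apply: DeriveDef; first by apply/cvg_ex; eexists; exact: f't.
exact: cvg_lim f't.
Unshelve. all: by end_near. Qed.

End solution_branch_theory.

Theorem theorem4p2 (R : realType) (a b : R) (hab : a < b)
    (p : R -> R -> R) (hval : valued_in a b p)
    (hH : hypothesis_H a b p)
    (hph : forall t : R, t \in `]a, b[ -> partial_h p t 0 != 0)
    (h : bool -> R -> R -> R)
    (hsol : forall (s : bool) (t : R), t \in `]a, b[ ->
       solution_branch p s t (h s t))
    (hlim : forall (s : bool) (t : R), t \in `]a, b[ ->
       exists2 l : R, l != 0 & eps / h s t eps @[eps --> (0 : R)^'+] --> l)
    (f g : R -> R)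
    (fcont : {within `[a, b], continuous f})
    (gcont : {within `[a, b], continuous g})
    (fdiff : forall t : R, t \in `]a, b[ -> p_differentiable p f t)
    (gdiff : forall t : R, t \in `]a, b[ -> p_differentiable p g t)
    (Dg_neq0 : forall t : R, t \in `]a, b[ -> Dp p g t != 0) :
  g b - g a != 0 /\
  exists2 c : R, c \in `]a, b[ &
    (f b - f a) / (g b - g a) = Dp p f c / Dp p g c.
Proof.
have der u t : t \in `]a, b[ -> p_differentiable p u t ->
    is_derive t 1 u (Dp p u t / partial_h p t 0).
  move=> tab du; have [pc dp _] := nbhs_singleton (hH.1 t tab).
  by apply: (@p_differentiable_is_derive _ _ _ (h ^~ t)) => // [|s];
    [exact: hph|exact: hsol].
have fder t (tab : t \in `]a, b[) := der f t tab (fdiff t tab).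
have gder t (tab : t \in `]a, b[) := der g t tab (gdiff t tab).
have g'0 t : t \in `]a, b[ -> Dp p g t / partial_h p t 0 != 0.
  by move=> tab; rewrite mulf_neq0 ?invr_eq0 ?hph ?Dg_neq0.
split; first exact: differentiable_subr_neq0 hab gcont gder g'0.
have [c cab <-] := cauchy_MVT hab fcont gcont fder gder g'0.
by exists c => //; rewrite invf_div mulrA divfK ?hph.
Qed.
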